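(* Let $d\ge2$, let $D_i=\operatorname{diag}(\lambda_1^{(i)},\dots,\lambda_d^{(i)})\in\mathbb C^{d\times d}$, $i=1,\dots,m$, be diagonal matrices, each with simple nonzero eigenvalues, such that $|\lambda_1^{(i)}|>\max_{r\ne1}|\lambda_r^{(i)}|$ for all $i$. Let $\Delta^{(i)}\in\mathbb C^{d\times d}$ with $\|\Delta^{(i)}\|_F=1$, and $A_i(\varepsilon)=D_i+\varepsilon\Delta^{(i)}$ for real $\varepsilon$. Let $p_1,\dots,p_m$ be probability weights. Set $$\eta:=\max_{1<r\le d,\ 1\le i\le m}\frac{|\lambda_r^{(i)}|}{|\lambda_1^{(i)}|}<1,\quad \lambda_{\min}:=\min_i|\lambda_1^{(i)}|,\quad\Delta_{\max}:=\max_i\|\Delta^{(i)}\|_F,\quad C_{\mathcal F}:=\frac{6\Delta_{\max}^2}{\lambda_{\min}^2(1-\eta)},$$ $$\alpha_i:=\Re\Bigl(\frac{\Delta_{11}^{(i)}}{\lambda_1^{(i)}}\Bigr),\qquad\widetilde\mu_\varepsilon:=\sum_{i=1}^m p_i\bigl(\log|\lambda_1^{(i)}|+\varepsilon\alpha_i\bigr),\qquad\widetilde\rho_\infty(\varepsilon):=\exp(\widetilde\mu_\varepsilon).$$ Then there exists $\varepsilon_0>0$, depending only on $\eta,\lambda_{\min},\Delta_{\max}$, such that for every $|\varepsilon|\le\varepsilon_0$, every $n\ge1$ and every $\sigma\in\{1,\dots,m\}^n$, $$\log\rho_n(\varepsilon,\sigma)=\frac1n\sum_{k=1}^n\bigl(\log|\lambda_1^{(\sigma_k)}|+\varepsilon\alpha_{\sigma_k}\bigr)+R_n(\varepsilon,\sigma),\qquad|R_n(\varepsilon,\sigma)|\le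 C_{\mathcal F}\,\varepsilon^2.$$ Moreover, for every $|\varepsilon|\le\varepsilon_0$, if $\omega=(\omega_k)_{k\ge1}\in\{1,\dots,m\}^{\mathbb N}$ is sampled with the product measure (i.i.d. coordinates, $\mathbb P(\omega_k=i)=p_i$) and $\omega|_n:=(\omega_1,\dots,\omega_n)$, then almost surely $$\limsup_{n\to\infty}\bigl|\log\rho_n(\varepsilon,\omega|_n)-\widetilde\mu_\varepsilon\bigr|\le C_{\mathcal F}\,\varepsilon^2;$$ equivalently, almost surely, $$e^{-C_{\mathcal F}\varepsilon^2}\widetilde\rho_\infty(\varepsilon)\le\liminf_{n\to\infty}\rho_n(\varepsilon,\omega|_n)\le\limsup_{n\to\infty}\rho_n(\varepsilon,\omega|_n)\le e^{C_{\mathcal F}\varepsilon^2}\widetilde\rho_\infty(\varepsilon).$$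
   Context: For a word $\sigma=(\sigma_1,\dots,\sigma_n)\in\{1,\dots,m\}^n$, $\Pi(\varepsilon,\sigma):=A_{\sigma_n}(\varepsilon)\cdots A_{\sigma_1}(\varepsilon)$ and $\rho_n(\varepsilon,\sigma):=\rho(\Pi(\varepsilon,\sigma))^{1/n}$, where $\rho(\cdot)$ is the spectral radius (largest modulus of an eigenvalue). $\|\cdot\|_F$ is the Frobenius norm. *)

(* Defs.v *)
(* Complex numbers are R[i] over R : realType. *)
From HB Require Import structures.
From mathcomp Require Import all_boot all_order all_algebra.
From mathcomp Require Import all_classical all_reals all_analysis.
From mathcomp Require Import complex.

Set Implicit Arguments.
Unset Strict Implicit.
Unset Printing Implicit Defensive.

Import Order.TTheory GRing.Theory Num.Theory.

Local Open Scope classical_set_scope.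
Local Open Scope ring_scope.

(* The modulus as an element of R; the norm `|z| of R[i] is valued in R[i]. *)
Notation modulus z := (ComplexField.Normc.normc z).

Section Matrices.
Context {R : realType}.

(* The set of eigenvalues is finite, and nonempty when n > 0 since R[i] is
   algebraically closed, so that sup is a maximum. *)
Definition spectral_radius n (A : 'M[R[i]]_n) : R :=
  sup [set modulus a | a in [set a | eigenvalue A a]].

Definition frobenius n (A : 'M[R[i]]_n) : R :=
  Num.sqrt (\sum_i \sum_j modulus (A i j) ^+ 2).

Definition simple_nonzero_eigenvalues n (A : 'M[R[i]]_n) : Prop :=
  forall a, eigenvalue A a -> mup a (char_poly A) = 1%N /\ a != 0.

End Matrices.

(* There are m.+1 matrices of size d.+2. The eigenvalues of the i-th diagonal
   matrix form the row vector lam i, with dominant entry lam i 0 0. *)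
Section Family.
Context {R : realType} {d m : nat}.
Variable lam : 'I_m.+1 -> 'rV[R[i]]_d.+2.
Variable Delta : 'I_m.+1 -> 'M[R[i]]_d.+2.

Definition perturbed (eps : R) (i : 'I_m.+1) : 'M[R[i]]_d.+2 :=
  diag_mx (lam i) + (real_complex R eps) *: Delta i.

(* Later letters multiply on the left. *)
Definition word_product (eps : R) (s : seq 'I_m.+1) : 'M[R[i]]_d.+2 :=
  foldl (fun M i => perturbed eps i *m M) 1%:M s.

Definition rho_word n (eps : R) (s : n.-tuple 'I_m.+1) : R :=
  spectral_radius (word_product eps s) `^ n%:R^-1.

(* The maximum ranges over a nonempty set of nonnegative reals, so starting
   from 0 is harmless; likewise for Delta_max. *)
Definition ratio_eta : R :=
  \big[Num.max/0]_(i < m.+1) \big[Num.max/0]_(r < d.+2 | r != 0)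
    (modulus (lam i 0 r) / modulus (lam i 0 0)).

Definition lambda_min : R :=
  \big[Num.min/modulus (lam ord0 0 0)]_(i < m.+1) modulus (lam i 0 0).

Definition Delta_max : R := \big[Num.max/0]_(i < m.+1) frobenius (Delta i).

Definition C_F : R := 6 * Delta_max ^+ 2 / (lambda_min ^+ 2 * (1 - ratio_eta)).

Definition alpha (i : 'I_m.+1) : R := complex.Re (Delta i 0 0 / lam i 0 0).

Definition log_term (eps : R) (i : 'I_m.+1) : R :=
  ln (modulus (lam i 0 0)) + eps * alpha i.

Definition mu_tilde (p : 'I_m.+1 -> R) (eps : R) : R :=
  \sum_(i < m.+1) p i * log_term eps i.

Definition rho_tilde (p : 'I_m.+1 -> R) (eps : R) : R := expR (mu_tilde p eps).

End Family.

Section Sampling.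
Context {R : realType} {dT : measure_display} {T : measurableType dT}.

(* The random sequence omega (indexed from 0) has i.i.d. coordinates of law p,
   that is, its law is the product measure with marginals p. *)
Definition iid_with_law (P : probability T R) m (p : 'I_m -> R)
    (omega : nat -> T -> 'I_m) : Prop :=
  [/\ forall k i, measurable (omega k @^-1` [set i]),
      forall k i, P (omega k @^-1` [set i]) = (p i)%:E
    & forall (J : seq nat) (E : nat -> set 'I_m), uniq J ->
        P (\bigcap_(k in [set` J]) (omega k @^-1` E k)) =
        (\prod_(k <- J) P (omega k @^-1` E k))%E].

Definition prefix_word m (omega : nat -> T -> 'I_m) n (w : T)
  : n.-tuple 'I_m := [tuple omega k w | k < n].

End Sampling.

(* Main.v *)
(* For |eps| small, the cone { |v'| <= r |v_1| } around the dominant coordinate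
   axis, with r of order eps, is invariant under every letter A, and A multiplies
   the first coordinate of a vector of the cone by a factor of modulus
   |lambda_1 + eps Delta_11| up to O(eps r) = O(eps^2). Iterating the whole word
   on e_1 bounds the spectral radius from below by the product of the lower
   factors; the norm max(|v_1|, |v'| / r) bounds it from above by the product of
   the upper ones, and both logarithms agree with the first-order term up to
   O(eps^2) per letter. The almost sure statement is then the strong law of large
   numbers for the log terms, obtained from a Chernoff bound over words and the
   Borel-Cantelli lemma. *)
Require Import Defs.
From HB Require Import structures.
From mathcomp Require Import all_boot all_order all_algebra.
From mathcomp Require Import all_classical all_reals all_analysis.
From mathcomp Require Import complex.
From mathcomp Require Import ring lra.

Set Implicit Arguments.
Unset Strict Implicit.
Unset Printing Implicit Defensive.

Import Order.TTheory GRing.Theory Num.Theory.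

Local Open Scope classical_set_scope.
Local Open Scope ring_scope.

Import ComplexField.Normc.


(** * Euclidean norms of finite real families *)

Section SquareSums.
Context {R : rcfType} {I : finType} (P : pred I).
Implicit Types f g : I -> R.

Definition l2norm f : R := Num.sqrt (\sum_(i | P i) f i ^+ 2).

Lemma sumsq_ge0 f : 0 <= \sum_(i | P i) f i ^+ 2.
Proof. by apply: sumr_ge0 => i _; exact: sqr_ge0. Qed.

Lemma l2norm_ge0 f : 0 <= l2norm f.
Proof. exact: sqrtr_ge0. Qed.

Lemma sqr_l2norm f : l2norm f ^+ 2 = \sum_(i | P i) f i ^+ 2.
Proof. by rewrite sqr_sqrtr ?sumsq_ge0. Qed.

(** Lagrange's identity: after doubling and transposing one copy of the double sum, the gap is a sum
    of squares [(f i * g j - f j * g i) ^+ 2]. *)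
Lemma cauchy_schwarz_sum f g : \sum_(i | P i) f i * g i <= l2norm f * l2norm g.
Proof.
have [le0|/ltW ge0] := leP (\sum_(i | P i) f i * g i) 0.
  by rewrite (le_trans le0)// mulr_ge0// l2norm_ge0.
rewrite -ler_sqr ?nnegrE ?mulr_ge0 ?l2norm_ge0//.
rewrite exprMn !sqr_l2norm expr2 !big_distrlr/=.
rewrite -(ler_pM2l (ltr0n R 2)) 2!mulr_natl 2!mulr2n.
rewrite [in leRHS](exchange_big)/= [in X in _ <= X + _]exchange_big/=.
rewrite -!big_split/=; apply: ler_sum => i _.
rewrite -!big_split/=; apply: ler_sum => j _.
have := sqr_ge0 (f i * g j - f j * g i); nra.
Qed.

Lemma l2normD f g : l2norm (fun i => f i + g i) <= l2norm f + l2norm g.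
Proof.
rewrite -ler_sqr ?nnegrE ?addr_ge0 ?l2norm_ge0// sqrrD !sqr_l2norm.
under eq_bigr do rewrite sqrrD.
rewrite !big_split/= lerD2r lerD2l -mulr2n lerMn2r/=.
exact: cauchy_schwarz_sum.
Qed.

Lemma l2norm_le f g : (forall i, P i -> 0 <= f i <= g i) -> l2norm f <= l2norm g.
Proof.
move=> fg; rewrite ler_wsqrtr// ler_sum// => i /fg/andP[f0 fg'].
by rewrite ler_sqr ?nnegrE// (le_trans f0).
Qed.

Lemma l2normZ c f : 0 <= c -> l2norm (fun i => c * f i) = c * l2norm f.
Proof.
move=> c0; rewrite /l2norm; under eq_bigr do rewrite exprMn.
by rewrite -mulr_sumr sqrtrM ?sqr_ge0// sqrtr_sqr ger0_norm.
Qed.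

End SquareSums.

(** * Moduli of complex numbers and first-order bounds on [|1 + z|] *)

Section Modulus.
Context {R : rcfType}.
Implicit Types z : R[i].

Lemma modulus_ge0 z : 0 <= modulus z.
Proof. by case: z => a b; exact: sqrtr_ge0. Qed.

Lemma modulus_gt0 z : (0 < modulus z) = (z != 0).
Proof.
rewrite lt_def modulus_ge0 andbT; congr negb; apply/eqP/eqP => [/eq0_normc//|->].
exact: normc0.
Qed.

Lemma modulus_real (e : R) : modulus (real_complex R e) = `|e|.
Proof. by rewrite /= expr0n addr0 sqrtr_sqr. Qed.

Lemma modulus_sum (I : Type) (r : seq I) (P : pred I) (F : I -> R[i]) :
  modulus (\sum_(i <- r | P i) F i) <= \sum_(i <- r | P i) modulus (F i).
Proof.
elim/big_ind2: _ => //; first by rewrite normc0.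
by move=> x a y b xa yb; rewrite (le_trans (le_normcD _ _))// lerD.
Qed.

Lemma modulus_subr z1 z2 : modulus z1 - modulus z2 <= modulus (z1 + z2).
Proof. by rewrite lerBlDr -(normcN z2) (le_trans _ (le_normcD _ _))// addrK. Qed.

Lemma Re_le_modulus z : complex.Re z <= modulus z.
Proof.
case: z => a b /=; rewrite (le_trans (ler_norm _))// -sqrtr_sqr ler_wsqrtr//.
by rewrite lerDl sqr_ge0.
Qed.

Lemma sqr_modulus1D z :
  modulus (1 + z) ^+ 2 = 1 + 2 * complex.Re z + modulus z ^+ 2.
Proof. case: z => a b /=; rewrite !sqr_sqrtr ?addr_ge0 ?sqr_ge0//; ring. Qed.

Lemma Re_le_modulus1D z : 1 + complex.Re z <= modulus (1 + z).
Proof. by case: z => a b; exact: (Re_le_modulus (1 + (a +i* b)%C)). Qed.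

(** Expand [(|1 + z| - 1)^2 >= 0]: the excess over [1 + Re z] is of second order. *)
Lemma modulus1D_le z :
  modulus (1 + z) <= 1 + complex.Re z + modulus z ^+ 2 / 2.
Proof.
have := sqr_modulus1D z; have := sqr_ge0 (modulus (1 + z) - 1).
by set a := modulus (1 + z); set b := modulus z; set c := complex.Re z; nra.
Qed.

End Modulus.

(** * Action of one perturbed diagonal matrix on head and tail of a vector *)

Section PerturbedDiagonal.
Context {R : realType}.

Lemma l2norm_subpred (I : finType) (P Q : pred I) (f : I -> R) :
  subpred P Q -> l2norm P f <= l2norm Q f.
Proof.
move=> PQ; rewrite ler_wsqrtr// [leRHS](bigID P)/=.
rewrite [X in _ <= X + _](eq_bigl P) => [|i /=]; last first.
  by rewrite andbC andb_idr//; exact: PQ.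
by rewrite lerDl; apply: sumsq_ge0.
Qed.

Lemma frobenius_ge0 n (A : 'M[R[i]]_n) : 0 <= frobenius A.
Proof. exact: sqrtr_ge0. Qed.

Lemma l2norm_row_le_frobenius n (A : 'M[R[i]]_n) (P : pred 'I_n) i :
  l2norm P (fun j => modulus (A i j)) <= frobenius A.
Proof.
apply: (@le_trans _ _ (l2norm predT (fun j => modulus (A i j)))).
  exact: l2norm_subpred.
rewrite ler_wsqrtr// [leRHS](bigD1 i)//= lerDl.
by apply: sumr_ge0 => k _; apply: sumsq_ge0.
Qed.

Lemma l2norm_mulmx_le n (A : 'M[R[i]]_n) (v : 'cV[R[i]]_n) :
  l2norm predT (fun i => modulus ((A *m v) i 0)) <=
  frobenius A * l2norm predT (fun i => modulus (v i 0)).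
Proof.
set x := l2norm predT (fun i => modulus (v i 0)).
rewrite -ler_sqr ?nnegrE ?mulr_ge0 ?l2norm_ge0 ?frobenius_ge0//.
rewrite exprMn sqr_l2norm sqr_sqrtr; last first.
  by apply: sumr_ge0 => i _; apply: sumsq_ge0.
rewrite mulr_suml; apply: ler_sum => i _.
rewrite -(sqr_l2norm _ (fun j => modulus (A i j))) -exprMn.
rewrite ler_sqr ?nnegrE ?mulr_ge0 ?l2norm_ge0 ?modulus_ge0//.
rewrite mxE (le_trans (modulus_sum _ _ _))//.
under eq_bigr do rewrite normcM.
exact: cauchy_schwarz_sum.
Qed.

Definition tail_norm n (v : 'cV[R[i]]_n.+1) : R :=
  l2norm (fun i => i != ord0) (fun i => modulus (v i 0)).

Lemma tail_norm_ge0 n (v : 'cV[R[i]]_n.+1) : 0 <= tail_norm v.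
Proof. exact: l2norm_ge0. Qed.

Lemma l2norm_le_tail n (v : 'cV[R[i]]_n.+1) :
  l2norm predT (fun i => modulus (v i 0)) <= modulus (v 0 0) + tail_norm v.
Proof.
have h0 := modulus_ge0 (v 0 0); have t0 := tail_norm_ge0 v.
rewrite -ler_sqr ?nnegrE ?addr_ge0 ?l2norm_ge0//.
rewrite sqr_l2norm (bigD1 ord0)//= sqrrD sqr_l2norm lerD2r lerDl.
by rewrite mulrn_wge0// mulr_ge0.
Qed.

Context {n : nat} (l : 'rV[R[i]]_n.+1) (D : 'M[R[i]]_n.+1) (e : R).
Let A := diag_mx l + real_complex R e *: D.
Implicit Types v : 'cV[R[i]]_n.+1.

Lemma mulmx_perturbed_diag v i :
  (A *m v) i 0 = l 0 i * v i 0 + real_complex R e * (D *m v) i 0.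
Proof. by rewrite mulmxDl mxE mul_diag_mx mxE -scalemxAl !mxE. Qed.

(** The error [z] is kept explicit so that the same identity serves the upper and the lower bound on
    the head. *)
Lemma perturbed_diag_head v :
  exists2 z : R[i],
    (A *m v) 0 0 = (l 0 0 + real_complex R e * D 0 0) * v 0 0 + z &
    modulus z <= `|e| * frobenius D * tail_norm v.
Proof.
exists (real_complex R e * \sum_(j | j != ord0) D 0 j * v j 0).
  rewrite mulmx_perturbed_diag mxE (bigD1 ord0)//= mulrDl mulrDr -!mulrA addrA.
  by [].
rewrite normcM modulus_real -mulrA ler_wpM2l// (le_trans (modulus_sum _ _ _))//.
under eq_bigr do rewrite normcM.
rewrite (le_trans (cauchy_schwarz_sum _ _ _))// ler_wpM2r ?l2norm_ge0//.
exact: l2norm_row_le_frobenius.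
Qed.

(** The diagonal part acts on the tail coordinatewise; the perturbation costs its Frobenius norm
    times the full norm of [v], which is at most head plus tail. *)
Lemma perturbed_diag_tail (L : R) v : 0 <= L ->
  (forall r : 'I_n.+1, r != 0 -> modulus (l 0 r) <= L) ->
  tail_norm (A *m v) <=
  L * tail_norm v + `|e| * frobenius D * (modulus (v 0 0) + tail_norm v).
Proof.
move=> L0 hL.
pose w i := modulus ((D *m v) i 0).
apply: (@le_trans _ _ (l2norm (fun i => i != ord0)
    (fun i => L * modulus (v i 0) + `|e| * w i))).
  apply: l2norm_le => i i0; rewrite modulus_ge0/= mulmx_perturbed_diag.
  rewrite (le_trans (le_normcD _ _))// !normcM modulus_real lerD2r.
  by rewrite ler_wpM2r ?modulus_ge0// hL.
rewrite (le_trans (l2normD _ _ _))// !l2normZ// lerD2l -mulrA ler_wpM2l//.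
apply: (@le_trans _ _ (l2norm predT w)); first exact: l2norm_subpred.
rewrite (le_trans (l2norm_mulmx_le _ _))// ler_wpM2l ?frobenius_ge0//.
exact: l2norm_le_tail.
Qed.

End PerturbedDiagonal.

(** * Spectral radius and growth of matrix powers *)

Section SpectralRadius.
Context {R : realType}.

Lemma exprn_ge1Dn (h : R) k : 0 <= h -> 1 + k%:R * h <= (1 + h) ^+ k.
Proof.
move=> h0; elim: k => [|k IH]; first by rewrite mul0r addr0 expr0.
rewrite exprS -natr1 (le_trans _ (ler_wpM2l _ IH)) ?addr_ge0//.
have : 0 <= k%:R * h * h by rewrite !mulr_ge0.
nra.
Qed.

(** If [x > y], Bernoulli's inequality makes [(x / y) ^+ k] exceed any constant. *)
Lemma exprn_growth_le (C x y : R) :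
  0 < y -> (forall k, x ^+ k <= C * y ^+ k) -> x <= y.
Proof.
move=> y0 xCy; rewrite leNgt; apply/negP => yx.
pose h := x / y - 1.
have h0 : 0 < h by rewrite subr_gt0 ltr_pdivlMr// mul1r.
have {}xCy k : 1 + k%:R * h <= C.
  rewrite (le_trans (exprn_ge1Dn _ (ltW h0)))// addrCA subrr addr0 expr_div_n.
  by rewrite ler_pdivrMr ?exprn_gt0.
have := xCy (Num.bound `|C / h|); rewrite leNgt => /negP; apply.
have : C / h < (Num.bound `|C / h|)%:R.
  by rewrite (le_lt_trans (ler_norm _))// archi_boundP.
by rewrite ltr_pdivrMr// => /lt_trans; apply; rewrite ltrDr.
Qed.

(** [eigenvalue] speaks of row vectors; transposition preserves the rank of [A - a%:M], so a column
    eigenvector exists too. *)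
Lemma eigenvalue_colP n (A : 'M[R[i]]_n) a :
  eigenvalue A a -> exists2 v : 'cV_n, v != 0 & A *m v = a *: v.
Proof.
move=> Aa; have /eigenvalueP[v /(congr1 trmx)] : eigenvalue A^T a.
  have r_lt : forall B : 'M[R[i]]_n, eigenvalue B a = (\rank (B - a%:M)%R < n)%N.
    move=> B; rewrite /eigenvalue /eigenspace -mxrank_eq0 mxrank_ker subn_eq0.
    by rewrite -ltnNge.
  by move: Aa; rewrite !r_lt -mxrank_tr linearB/= tr_scalar_mx.
rewrite trmx_mul trmxK linearZ/= => vA v0; exists v^T => //.
by rewrite -trmx0 (inj_eq trmx_inj).
Qed.

Lemma char_poly_split n (A : 'M[R[i]]_n.+1) : exists s : seq R[i],
  char_poly A = \prod_(z <- s) ('X - z%:P) /\ (forall a, eigenvalue A a = (a \in s)).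
Proof.
have [s sE] := closed_field_poly_normal (char_poly A).
move: sE; rewrite (monicP (char_poly_monic A)) scale1r => sE.
by exists s; split=> // a; rewrite eigenvalue_root_char sE root_prod_XsubC.
Qed.

Lemma eigenvalue_le_spectral_radius n (A : 'M[R[i]]_n.+1) a :
  eigenvalue A a -> modulus a <= spectral_radius A.
Proof.
move=> Aa; apply: ub_le_sup; last by exists a.
have [s [_ sP]] := char_poly_split A.
(* The sum of the moduli of all roots bounds the set, so that [sup] is a genuine supremum. *)
exists (\sum_(z <- s) modulus z) => _ [z /= + <-]; rewrite sP => zs.
rewrite (big_rem z)//= lerDl; apply: sumr_ge0 => i _; exact: modulus_ge0.
Qed.

Lemma spectral_radius_le n (A : 'M[R[i]]_n.+1) (B : R) :
  (forall a, eigenvalue A a -> modulus a <= B) -> spectral_radius A <= B.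
Proof.
move=> AB; apply: ge_sup => [|_ [a /= Aa <-]]; last exact: AB.
have [s [sE sP]] := char_poly_split A.
(* The characteristic polynomial has positive degree, hence a root: the set under [sup] is
   nonempty. *)
have := size_char_poly A; rewrite sE size_prod_XsubC => -[sn].
have /hasP[z zs _] : has predT s by rewrite has_predT sn.
by exists (modulus z), z => //=; rewrite sP.
Qed.

(* Cayley-Hamilton turns (M^k v)_i into a linear recurrent sequence whose
   characteristic roots are the eigenvalues; peeling off one root [z] at a time,
   x (k + 1) - z * x k satisfies the recurrence with one root less. *)
Lemma mulmx_exp_growth n (M : 'M[R[i]]_n.+1) (rho t : R) (s : seq R[i])
    (v : 'cV[R[i]]_n.+1) (i : 'I_n.+1) :
  0 < t -> rho < t -> (forall z, z \in s -> modulus z <= rho) ->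
  horner_mx M (\prod_(z <- s) ('X - z%:P)) *m v = 0 ->
  exists C : R, forall k, modulus ((M ^+ k *m v) i 0) <= C * t ^+ k.
Proof.
move=> t0 rt; elim: s v => [|z s IH] v srho.
  rewrite big_nil rmorph1 mul1mx => ->; exists 0 => k.
  by rewrite mulmx0 mxE normc0 mul0r.
rewrite big_cons mulrC rmorphM/= -mulmxE -mulmxA => /IH[y ys|C hC].
  by apply: srho; rewrite inE ys orbT.
have zrho : modulus z <= rho by apply: srho; rewrite mem_head.
have C0 : 0 <= C.
  by have := hC 0%N; rewrite mulr1; apply: le_trans; exact: modulus_ge0.
pose x k := modulus ((M ^+ k *m v) i 0).
have xS k : x k.+1 <= rho * x k + C * t ^+ k.
  have -> : x k.+1 = modulus (z * (M ^+ k *m v) i 0 +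
      (M ^+ k *m (horner_mx M ('X - z%:P) *m v)) i 0).
    rewrite /x rmorphB/= horner_mx_X horner_mx_C mulmxBl mulmxBr mul_scalar_mx.
    rewrite -scalemxAr mulmxA mulmxE -exprSr.
    have -> (P Q : 'cV[R[i]]_n.+1) : (P - z *: Q) i 0 = P i 0 - z * Q i 0.
      by rewrite !mxE.
    by rewrite addrC subrK.
  rewrite (le_trans (le_normcD _ _))// lerD// normcM ler_wpM2r//.
  exact: modulus_ge0.
(* With [K = C / (t - rho)], [rho * K + C = K * t], so [K * t ^+ k] absorbs the inhomogeneous term;
   the remaining slack is [x 0 * (t - rho) * t ^+ k]. *)
exists (x 0%N + C / (t - rho)); elim=> [|k IHk].
  by rewrite expr0 mulr1 lerDl divr_ge0// subr_ge0 ltW.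
have rho0 : 0 <= rho := le_trans (modulus_ge0 z) zrho.
rewrite (le_trans (xS k))// (le_trans (lerD (ler_wpM2l rho0 IHk) (lexx _)))//.
have CE : C = C / (t - rho) * (t - rho) by rewrite divfK// gt_eqF// subr_gt0.
move: CE; set K := C / (t - rho) => CE; set X := x 0%N.
rewrite -subr_ge0 exprS.
rewrite (_ : _ - _ = X * (t - rho) * t ^+ k); last by rewrite CE; ring.
by rewrite !mulr_ge0 ?modulus_ge0 ?exprn_ge0// ?subr_ge0 ltW.
Qed.

(** The powers grow at most like [C * t ^+ k] for each [t] above the spectral radius. The margin [e]
    absorbs the polynomial factors due to repeated eigenvalues and is then sent to 0. *)
Lemma growth_le_spectral_radius n (M : 'M[R[i]]_n.+1) (v : 'cV[R[i]]_n.+1) i x :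
  (forall k, x ^+ k <= modulus ((M ^+ k *m v) i 0)) -> x <= spectral_radius M.
Proof.
move=> xM; apply/ler_addgt0Pr => e e0.
have [s [sE sP]] := char_poly_split M.
have rho_ge0 : 0 <= spectral_radius M.
  have := size_char_poly M; rewrite sE size_prod_XsubC => -[sn].
  have /hasP[z zs _] : has predT s by rewrite has_predT sn.
  by rewrite (le_trans (modulus_ge0 z))// eigenvalue_le_spectral_radius// sP.
have t0 : 0 < spectral_radius M + e by rewrite ltr_wpDl.
have [|||C hC] := @mulmx_exp_growth _ M (spectral_radius M) _ s v i t0.
- by rewrite ltrDl.
- by move=> z zs; rewrite eigenvalue_le_spectral_radius// sP.
- by rewrite -sE Cayley_Hamilton mul0mx.
- by apply: (exprn_growth_le t0 (C := C)) => k; exact: le_trans (hC k).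
Qed.

End SpectralRadius.

(** * One letter acting on the cone *)

Section InvariantCone.
Context {R : realType} {n : nat}.
Variables (l : 'rV[R[i]]_n.+1) (D : 'M[R[i]]_n.+1) (e L r : R).
Let A := diag_mx l + real_complex R e *: D.
Let a := modulus (l 0 0 + real_complex R e * D 0 0).
Let E := `|e| * frobenius D.
Hypothesis r0 : 0 <= r.
Hypothesis L0 : 0 <= L.
Hypothesis lL : forall j : 'I_n.+1, j != 0 -> modulus (l 0 j) <= L.
Hypothesis coneLE : L * r + E * (1 + r) <= r * (a - E * r).
Implicit Types v : 'cV[R[i]]_n.+1.

Let E0 : 0 <= E.
Proof. by rewrite mulr_ge0// frobenius_ge0. Qed.

(** The two premises say that [v] has norm at most [N] for [max(|v_1|, |v'| / r)]; [v] need not lie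
    in the cone. [coneLE] bounds the tail by the lower factor, which is at most [a + E * r]. *)
Lemma perturbed_diag_upper v N :
  modulus (v 0 0) <= N -> tail_norm v <= r * N ->
  modulus ((A *m v) 0 0) <= (a + E * r) * N /\
  tail_norm (A *m v) <= r * ((a + E * r) * N).
Proof.
move=> hN tN; have N0 : 0 <= N := le_trans (modulus_ge0 _) hN.
have a0 : 0 <= a := modulus_ge0 _.
split.
  have [z -> zE] := perturbed_diag_head l D e v.
  rewrite (le_trans (le_normcD _ _))// normcM mulrDl lerD//.
    by rewrite ler_wpM2l.
  by rewrite (le_trans zE)// -/E -[leRHS]mulrA ler_wpM2l.
rewrite (le_trans (perturbed_diag_tail D e v L0 lL))// -/E.
have h1 : L * tail_norm v <= L * (r * N) by rewrite ler_wpM2l.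
have h2 : E * (modulus (v 0 0) + tail_norm v) <= E * (N + r * N).
  by rewrite ler_wpM2l// lerD.
rewrite (le_trans (lerD h1 h2))//.
have := ler_wpM2r N0 coneLE; rewrite mulrDl.
have : 0 <= r * E * r * N by rewrite !mulr_ge0 ?frobenius_ge0.
by move: E a => E' a'; lra.
Qed.

(** In the cone the off-diagonal entries of the first row cost at most [E * r] times the head;
    [coneLE] then compares the new tail with the new head, giving invariance. *)
Lemma perturbed_diag_lower v :
  tail_norm v <= r * modulus (v 0 0) ->
  (a - E * r) * modulus (v 0 0) <= modulus ((A *m v) 0 0) /\
  tail_norm (A *m v) <= r * modulus ((A *m v) 0 0).
Proof.
set N := modulus (v 0 0) => tN; have N0 : 0 <= N := modulus_ge0 _.
have hw : (a - E * r) * N <= modulus ((A *m v) 0 0).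
  have [z -> zE] := perturbed_diag_head l D e v.
  rewrite (le_trans _ (modulus_subr _ _))// normcM mulrBl lerB//.
  by rewrite (le_trans zE)// -/E -[leRHS]mulrA ler_wpM2l.
split=> //; rewrite (le_trans _ (ler_wpM2l r0 hw))//.
rewrite (le_trans (perturbed_diag_tail D e v L0 lL))// -/E -/N.
have h1 : L * tail_norm v <= L * (r * N) by rewrite ler_wpM2l.
have h2 : E * (N + tail_norm v) <= E * (N + r * N) by rewrite ler_wpM2l// lerD2l.
rewrite (le_trans (lerD h1 h2))//.
have := ler_wpM2r N0 coneLE.
by move: E a => E' a'; lra.
Qed.

End InvariantCone.

(** * Two-sided bounds on the spectral radius of a word *)

Section Words.
Context {R : realType} {d m : nat}.
Variables (lam : 'I_m.+1 -> 'rV[R[i]]_d.+2) (Delta : 'I_m.+1 -> 'M[R[i]]_d.+2).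
Variables (eps r : R) (L : 'I_m.+1 -> R).
Let a i := modulus (lam i 0 0 + real_complex R eps * Delta i 0 0).
Let E i := `|eps| * frobenius (Delta i).
Hypothesis r0 : 0 < r.
Hypothesis L0 : forall i, 0 <= L i.
Hypothesis lL : forall i (j : 'I_d.+2), j != 0 -> modulus (lam i 0 j) <= L i.
Hypothesis coneLE : forall i, L i * r + E i * (1 + r) <= r * (a i - E i * r).

Lemma word_product_rcons s i :
  word_product lam Delta eps (rcons s i) =
  perturbed lam Delta eps i *m word_product lam Delta eps s.
Proof. by rewrite /word_product foldl_rcons. Qed.

Lemma word_product_upper s (v : 'cV[R[i]]_d.+2) N :
  modulus (v 0 0) <= N -> tail_norm v <= r * N ->
  modulus ((word_product lam Delta eps s *m v) 0 0) <=
    (\prod_(i <- s) (a i + E i * r)) * N /\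
  tail_norm (word_product lam Delta eps s *m v) <=
    r * ((\prod_(i <- s) (a i + E i * r)) * N).
Proof.
move=> hN tN; elim/last_ind: s => [|s i [IH1 IH2]].
  by rewrite big_nil !mul1r mul1mx.
rewrite word_product_rcons -mulmxA.
rewrite -cats1 big_cat big_seq1/= [(\prod_(_ <- _) _) * _]mulrC.
rewrite -(mulrA (a i + E i * r)).
exact: (perturbed_diag_upper (ltW r0) (L0 i) (lL i) (coneLE i) IH1 IH2).
Qed.

(** Apply the norm bound to an eigenvector [v] of norm [N]: the image [b *: v] has norm [|b| * N],
    so [|b|] is at most the product. *)
Lemma spectral_radius_word_le s :
  spectral_radius (word_product lam Delta eps s) <=
  \prod_(i <- s) (a i + E i * r).
Proof.
apply: spectral_radius_le => b /eigenvalue_colP[v v0 vE].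
pose N := Num.max (modulus (v 0 0)) (tail_norm v / r).
have hN : modulus (v 0 0) <= N by rewrite le_max lexx.
have tN : tail_norm v <= r * N by rewrite mulrC -ler_pdivrMr// le_max lexx orbT.
(* If [N] vanished, head and tail would vanish, and with them every coordinate of [v]. *)
have N0 : 0 < N.
  rewrite lt_neqAle (le_trans (modulus_ge0 _) hN) andbT eq_sym.
  apply: contra v0 => /eqP NE; apply/eqP/matrixP => j k; rewrite ord1 mxE.
  apply: eq0_normc; apply: le_anti; rewrite modulus_ge0 andbT.
  have := l2norm_le_tail v; rewrite -[leRHS]addr0.
  move: hN tN; rewrite NE mulr0 => hN tN hv.
  apply: (@le_trans _ _ (l2norm predT (fun i => modulus (v i 0)))).
    rewrite -ler_sqr ?nnegrE ?modulus_ge0 ?l2norm_ge0// sqr_l2norm.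
    by rewrite (bigD1 j)//= lerDl; apply: sumsq_ge0.
  by move: hv; lra.
have [] := word_product_upper s hN tN; rewrite vE.
set U := \prod_(i <- s) _; move=> h1 h2.
rewrite -(ler_pM2r N0).
have b0 := modulus_ge0 b.
rewrite {1}/N maxr_pMr// ge_max; apply/andP; split.
  by move: h1; rewrite mxE normcM.
rewrite mulrA ler_pdivrMr// mulrC [X in _ <= X]mulrC (le_trans _ h2)//.
rewrite /tail_norm -[X in X <= _]mulrC -l2normZ//; apply: l2norm_le => j _.
by rewrite mulr_ge0 ?modulus_ge0//= mxE normcM.
Qed.

Hypothesis aE : forall i, 0 <= a i - E i * r.

Lemma word_product_lower s (v : 'cV[R[i]]_d.+2) :
  tail_norm v <= r * modulus (v 0 0) ->
  (\prod_(i <- s) (a i - E i * r)) * modulus (v 0 0) <=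
    modulus ((word_product lam Delta eps s *m v) 0 0) /\
  tail_norm (word_product lam Delta eps s *m v) <=
    r * modulus ((word_product lam Delta eps s *m v) 0 0).
Proof.
move=> tv; elim/last_ind: s => [|s i [IH1 IH2]].
  by rewrite big_nil mul1r mul1mx.
rewrite word_product_rcons -mulmxA.
have [h1 h2] := perturbed_diag_lower (ltW r0) (L0 i) (lL i) (coneLE i) IH2.
split=> //; rewrite (le_trans _ h1)//.
rewrite -cats1 big_cat big_seq1/= [(\prod_(_ <- _) _) * _]mulrC.
rewrite -(mulrA (a i - E i * r)); exact: ler_wpM2l.
Qed.

Lemma prod_le_spectral_radius_word s :
  \prod_(i <- s) (a i - E i * r) <=
  spectral_radius (word_product lam Delta eps s).
Proof.
pose v : 'cV[R[i]]_d.+2 := delta_mx 0 0.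
have v1 : modulus (v 0 0) = 1 by rewrite mxE normc1.
have v2 : tail_norm v = 0.
  rewrite /tail_norm /l2norm big1 ?sqrtr0// => j j0.
  by rewrite mxE (negPf j0) normc0 expr0n.
apply: (@growth_le_spectral_radius _ _ _ v 0) => k.
(* Membership in the cone is carried along, since the next pass through the word requires it. *)
suff [] : (\prod_(i <- s) (a i - E i * r)) ^+ k <=
    modulus ((word_product lam Delta eps s ^+ k *m v) 0 0) /\
  tail_norm (word_product lam Delta eps s ^+ k *m v) <=
    r * modulus ((word_product lam Delta eps s ^+ k *m v) 0 0) by [].
elim: k => [|k [IH1 IH2]]; first by rewrite !expr0 mul1mx v1 v2 mulr1 (ltW r0).
rewrite !exprS -mulmxE -mulmxA.
have [h1 h2] := word_product_lower s IH2.
split=> //; rewrite (le_trans _ h1)// ler_wpM2l//.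
by apply: prodr_ge0 => i _.
Qed.

End Words.

(** * Scalar estimates for a letter divided by its dominant eigenvalue *)

Section Estimates.
Context {R : realType}.

Lemma ln_le_subr1 (x : R) : 0 < x -> ln x <= x - 1.
Proof. by move=> x0; have := expR_ge1Dx (ln x); rewrite lnK ?posrE//; lra. Qed.

(** [ln x <= x - 1] at [x = (1 + y)^-1] gives [ln (1 + y) >= y / (1 + y)], and this exceeds
    [y - 2 * y ^+ 2] by [y ^+ 2 * (1 + 2 * y) / (1 + y)]. *)
Lemma ln1D_ge (y : R) : - 2^-1 <= y -> y - 2 * y ^+ 2 <= ln (1 + y).
Proof.
move=> hy; have y0 : 0 < 1 + y by lra.
have := ln_le_subr1 (x := (1 + y)^-1); rewrite invr_gt0 => /(_ y0).
rewrite lnV ?posrE//; move=> h.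
have : y - 2 * y ^+ 2 <= 1 - (1 + y)^-1.
  rewrite -subr_ge0 (_ : _ - _ = y ^+ 2 * (1 + 2 * y) / (1 + y)); last first.
    by field; rewrite gt_eqF.
  have y1 : 0 <= 1 + 2 * y by lra.
  by apply: divr_ge0 (ltW y0); exact: mulr_ge0 (sqr_ge0 y) y1.
lra.
Qed.

(* r = 2 delta / (1 - eta), except that for delta = 0 one still needs r > 0 for
   the norm max(|v_1|, |v'| / r) to make sense. *)
Lemma cone_radius (delta eta : R) : 0 <= delta -> 0 <= eta -> eta < 1 ->
  delta <= (1 - eta) / 5 ->
  exists r, [/\ 0 < r, r <= 2 / 5, delta * (1 + r) ^+ 2 <= (1 - eta) * r &
    delta * r <= 2 * delta ^+ 2 / (1 - eta)].
Proof.
move=> d0 e0 e1 de; have e1' : 0 < 1 - eta by lra.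
have [->|dn0] := eqVneq delta 0.
  exists (2 / 5); rewrite !mul0r expr0n/= mulr0 mul0r; split=> //.
  lra.
have dp : 0 < delta by rewrite lt_def dn0.
exists (2 * delta / (1 - eta)).
have rE : (1 - eta) * (2 * delta / (1 - eta)) = 2 * delta.
  by field; rewrite gt_eqF.
have r0 : 0 < 2 * delta / (1 - eta) by rewrite divr_gt0// mulr_gt0.
have r2 : 2 * delta / (1 - eta) <= 2 / 5 by rewrite ler_pdivrMr//; lra.
split=> //.
  (* [r <= 2 / 5] gives [(1 + r) ^+ 2 <= 49 / 25 < 2]. *)
  rewrite rE mulrC ler_wpM2r//; move: r0 r2; set r := 2 * delta / _; nra.
by rewrite (_ : _ * _ = 2 * delta ^+ 2 / (1 - eta))//; ring.
Qed.

Variables (delta eta r : R).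
Hypotheses (d0 : 0 <= delta) (e0 : 0 <= eta) (e1 : eta < 1).
Hypotheses (de : delta <= (1 - eta) / 5) (r0 : 0 < r) (r2 : r <= 2 / 5).
Hypothesis rcone : delta * (1 + r) ^+ 2 <= (1 - eta) * r.
Hypothesis rsmall : delta * r <= 2 * delta ^+ 2 / (1 - eta).
Variables (z : R[i]) (w : R).
Hypotheses (w0 : 0 <= w) (wd : w <= delta) (zd : modulus z <= delta).

Let Re_ge : - delta <= complex.Re z.
Proof.
have := Re_le_modulus (- z); rewrite normcN.
have -> : complex.Re (- z) = - complex.Re z by case: (z).
by move: zd; lra.
Qed.

Let wr : w * r <= delta * r. Proof. by rewrite ler_wpM2r// ltW. Qed.

(** This is [coneLE] divided by [|lambda_1|], to be used with [z = eps * Delta_11 / lambda_1],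
    [w = |eps| / |lambda_1|] and [delta = |eps| / lambda_min]. As [|1 + z| >= 1 - delta], it reduces
    to [rcone]. *)
Lemma cone_condition :
  eta * r + w * (1 + r) <= r * (modulus (1 + z) - w * r).
Proof.
have b1 : 1 - delta <= modulus (1 + z).
  by have := Re_le_modulus1D z; move: Re_ge; lra.
have := ler_wpM2l (ltW r0) b1.
have : w * (1 + r + r ^+ 2) <= delta * (1 + r + r ^+ 2).
  by rewrite ler_wpM2r// !addr_ge0 ?sqr_ge0// ltW.
move: rcone; set b := modulus _; nra.
Qed.

Let delta_r_le : delta * r <= 2 / 25.
Proof.
have d5 : delta <= 1 / 5 by move: de e0; lra.
rewrite (_ : 2 / 25 = 1 / 5 * (2 / 5)); last by field.
by rewrite ler_pM// ltW.
Qed.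

Let sqr_delta_le : delta ^+ 2 <= delta ^+ 2 / (1 - eta).
Proof.
rewrite ler_pdivlMr ?subr_gt0//.
by have := mulr_ge0 (sqr_ge0 delta) e0; lra.
Qed.

Lemma modulus1D_subr_gt0 : 0 < modulus (1 + z) - w * r.
Proof.
have := Re_le_modulus1D z; move: Re_ge wr delta_r_le e0 de; lra.
Qed.

(** In units of [delta ^+ 2 / (1 - eta)], the losses are 1/2 from [modulus1D_le] and 2 from
    [w * r]. *)
Lemma ln_modulus1D_upper :
  ln (modulus (1 + z) + w * r) <=
  complex.Re z + 6 * (delta ^+ 2 / (1 - eta)).
Proof.
have p : 0 < modulus (1 + z) + w * r.
  rewrite (lt_le_trans modulus1D_subr_gt0)// lerD2l.
  by have := mulr_ge0 w0 (ltW r0); lra.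
rewrite (le_trans (ln_le_subr1 p))//.
have := modulus1D_le z.
have : modulus z ^+ 2 <= delta ^+ 2.
  by rewrite ler_sqr ?nnegrE ?modulus_ge0.
move: wr rsmall sqr_delta_le; rewrite -mulrA.
have : 0 <= delta ^+ 2 / (1 - eta) by rewrite divr_ge0 ?sqr_ge0// subr_ge0 ltW.
lra.
Qed.

(** Here the constant 6 of [C_F] arises: 2 from [delta * r], and 4 from the quadratic loss in
    [ln1D_ge], where [y ^+ 2 <= 2 * delta ^+ 2]. *)
Lemma ln_modulus1D_lower :
  complex.Re z - 6 * (delta ^+ 2 / (1 - eta)) <=
  ln (modulus (1 + z) - w * r).
Proof.
pose y := complex.Re z - delta * r.
have yr : `|y| <= delta * (1 + r).
  rewrite ler_norml; apply/andP; split; rewrite /y.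
    by move: Re_ge; lra.
  by have := Re_le_modulus z; have := mulr_ge0 d0 (ltW r0); move: zd; lra.
have hy : - 2^-1 <= y.
  by move: yr delta_r_le; rewrite ler_norml => /andP[+ _]; move: e0 de; lra.
have y2 : y ^+ 2 <= 2 * delta ^+ 2.
  rewrite -real_normK ?num_real//.
  have r1 : 0 <= 1 + r by rewrite addr_ge0// ltW.
  have := yr; rewrite -ler_sqr ?nnegrE ?mulr_ge0//.
  move/le_trans; apply; rewrite exprMn mulrC ler_wpM2r ?sqr_ge0//.
  by move: r0 r2; nra.
have := ln1D_ge hy.
have : ln (1 + y) <= ln (modulus (1 + z) - w * r).
  rewrite ler_ln ?posrE ?modulus1D_subr_gt0//; last by lra.
  by have := Re_le_modulus1D z; move: wr; rewrite /y; lra.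
move: rsmall y2 sqr_delta_le; rewrite /y -mulrA; lra.
Qed.

End Estimates.

(** * Uniform logarithmic estimate for all words of the family *)

Section Family.
Context {R : realType} {d m : nat}.
Variables (lam : 'I_m.+1 -> 'rV[R[i]]_d.+2) (Delta : 'I_m.+1 -> 'M[R[i]]_d.+2).
Hypothesis lam_dom : forall i (r : 'I_d.+2), r != 0 ->
  modulus (lam i 0 r) < modulus (lam i 0 0).
Hypothesis Delta1 : forall i, frobenius (Delta i) = 1.

Lemma modulus_lam_gt0 i : 0 < modulus (lam i 0 0).
(* The size is at least 2, so [ord_max] is a non-dominant index. *)
Proof. by apply: le_lt_trans (modulus_ge0 (lam i 0 ord_max)) _; exact: lam_dom. Qed.

Lemma ratio_eta_lt1 : ratio_eta lam < 1.
Proof.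
apply: bigmax_lt => // i _; apply: bigmax_lt => // r r0.
by rewrite ltr_pdivrMr ?modulus_lam_gt0// mul1r lam_dom.
Qed.

Lemma modulus_lam_le i (r : 'I_d.+2) : r != 0 ->
  modulus (lam i 0 r) <= ratio_eta lam * modulus (lam i 0 0).
Proof.
move=> r0; rewrite -ler_pdivrMr ?modulus_lam_gt0//.
pose F i := \big[Num.max/0]_(r < d.+2 | r != 0)
  (modulus (lam i 0 r) / modulus (lam i 0 0)).
apply: (@le_trans _ _ (F i)); last exact: (le_bigmax _ F).
exact: (le_bigmax_cond _ (fun r => modulus (lam i 0 r) / modulus (lam i 0 0))).
Qed.

Lemma ratio_eta_ge0 : 0 <= ratio_eta lam.
Proof.
have /(le_trans (modulus_ge0 _)) := @modulus_lam_le ord0 ord_max isT.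
by rewrite pmulr_lge0// modulus_lam_gt0.
Qed.

Lemma lambda_min_gt0 : 0 < lambda_min lam.
Proof. by apply: lt_bigmin => [|i _]; exact: modulus_lam_gt0. Qed.

Lemma lambda_min_le i : lambda_min lam <= modulus (lam i 0 0).
Proof. exact: (bigmin_le _ i (fun i => modulus (lam i 0 0))). Qed.

Lemma Delta_max_eq1 : Delta_max Delta = 1.
Proof.
apply/eqP; rewrite eq_le; apply/andP; split.
  by apply: bigmax_le => // i _; rewrite Delta1.
by rewrite -(Delta1 ord0); exact: (le_bigmax _ (fun i => frobenius (Delta i))).
Qed.

Lemma ln_prod (I : Type) (s : seq I) (f : I -> R) : (forall i, 0 < f i) ->
  ln (\prod_(i <- s) f i) = \sum_(i <- s) ln (f i).
Proof.
move=> f0; elim: s => [|i s IH]; first by rewrite !big_nil ln1.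
by rewrite !big_cons lnM ?IH// posrE ?prodr_gt0.
Qed.

Variable eps : R.
Hypothesis eps_small :
  `|eps| <= lambda_min lam * (1 - ratio_eta lam) / (5 * Delta_max Delta).

(** Taking logarithms turns the products bounding the spectral radius into sums, and each letter
    contributes an error of at most [C_F * eps ^+ 2]. *)
Lemma ln_spectral_radius_word (s : seq 'I_m.+1) :
  0 < spectral_radius (word_product lam Delta eps s) /\
  `|ln (spectral_radius (word_product lam Delta eps s)) -
    \sum_(i <- s) log_term lam Delta eps i| <=
  (size s)%:R * (C_F lam Delta * eps ^+ 2).
Proof.
pose eta := ratio_eta lam; pose delta := `|eps| / lambda_min lam.
have lmin0 := lambda_min_gt0.
have delta0 : 0 <= delta by rewrite divr_ge0// ltW.
have eta0 : 0 <= eta := ratio_eta_ge0; have eta1 : eta < 1 := ratio_eta_lt1.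
have delta_le : delta <= (1 - eta) / 5.
  rewrite ler_pdivrMr// (le_trans eps_small)// Delta_max_eq1 mulr1.
  by rewrite mulrC mulrA mulrAC [_^-1 * _]mulrC.
have CE : C_F lam Delta * eps ^+ 2 = 6 * (delta ^+ 2 / (1 - eta)).
  rewrite /C_F Delta_max_eq1 -(real_normK (num_real eps)) /delta -/eta.
  have ln0 : lambda_min lam != 0 by rewrite gt_eqF.
  have en0 : 1 - eta != 0 by rewrite gt_eqF// subr_gt0.
  by field; rewrite ln0 en0.
(* The radius depends only on [delta] and [eta], so a single cone serves all letters. *)
have [r [r0 r2 rcone rsmall]] := cone_radius delta0 eta0 eta1 delta_le.
pose q i := modulus (lam i 0 0); have q0 i : 0 < q i := modulus_lam_gt0 i.
pose z i := real_complex R eps * (Delta i 0 0 / lam i 0 0).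
pose w i := `|eps| / q i.
have w0 i : 0 <= w i by rewrite divr_ge0// ltW.
have wd i : w i <= delta.
  by rewrite ler_wpM2l// lef_pV2 ?posrE//; exact: lambda_min_le.
have zd i : modulus (z i) <= delta.
  rewrite (le_trans _ (wd i))// !normcM normcV modulus_real ler_wpM2l//.
  rewrite -[leRHS]mul1r ler_wpM2r ?invr_ge0 ?modulus_ge0//.
  rewrite -(Delta1 i) (le_trans _ (l2norm_row_le_frobenius _ predT 0))//.
  rewrite -ler_sqr ?nnegrE ?modulus_ge0 ?l2norm_ge0// sqr_l2norm.
  by rewrite (bigD1 0)//= lerDl; apply: sumsq_ge0.
have Rez i : complex.Re (z i) = eps * alpha lam Delta i.
  by rewrite /z /alpha; case: (_ / _) => a b /=; rewrite mul0r subr0.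
pose a i := modulus (lam i 0 0 + real_complex R eps * Delta i 0 0).
have aE i : a i = q i * modulus (1 + z i).
  rewrite /a /q -normcM mulrDr mulr1 /z; congr (modulus (_ + _)).
  by rewrite mulrCA [lam i 0 0 * _]mulrC divfK// -modulus_gt0 modulus_lam_gt0.
pose E i := `|eps| * frobenius (Delta i).
have EE i : E i = q i * w i.
  by rewrite /E /w Delta1 mulr1 mulrC divfK// gt_eqF.
have coneLE i : eta * q i * r + E i * (1 + r) <= r * (a i - E i * r).
  have := cone_condition r0 rcone (wd i) (zd i).
  rewrite -(ler_pM2l (q0 i)) aE EE; lra.
have aErE i : a i - E i * r = q i * (modulus (1 + z i) - w i * r).
  by rewrite aE EE; ring.
have aEr0 i : 0 < modulus (1 + z i) - w i * r.
  exact: (modulus1D_subr_gt0 delta0 eta0 delta_le r0 r2 (wd i) (zd i)).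
have aEr i : 0 < a i - E i * r by rewrite aErE mulr_gt0.
have aEr1 i : 0 < a i + E i * r.
  rewrite (lt_le_trans (aEr i))// lerD2l.
  have : 0 <= E i * r
    by rewrite EE; exact: mulr_ge0 (mulr_ge0 (ltW (q0 i)) (w0 i)) (ltW r0).
  lra.
have L0 i : 0 <= eta * q i by rewrite mulr_ge0// ltW.
have hU := spectral_radius_word_le r0 L0 modulus_lam_le coneLE s.
have hL := prod_le_spectral_radius_word r0 L0 modulus_lam_le coneLE
  (fun i => ltW (aEr i)) s.
have rho0 : 0 < spectral_radius (word_product lam Delta eps s).
  by apply: lt_le_trans hL; apply: prodr_gt0 => i _; exact: aEr.
have sumC : (size s)%:R * (6 * (delta ^+ 2 / (1 - eta))) =
    \sum_(i <- s) 6 * (delta ^+ 2 / (1 - eta)).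
  by rewrite big_const_seq count_predT iter_addr_0 mulr_natl.
split=> //; rewrite CE sumC ler_distl; apply/andP; split.
  have := hL; rewrite -ler_ln ?posrE//; last by apply: prodr_gt0 => i _; exact: aEr.
  rewrite ln_prod//; apply: le_trans.
  rewrite -sumrB; apply: ler_sum => i _.
  rewrite aErE lnM ?posrE// /log_term -Rez -addrA lerD2l.
  exact: (ln_modulus1D_lower delta0 eta0 eta1 delta_le r0 r2 rsmall (wd i) (zd i)).
have := hU; rewrite -ler_ln ?posrE//; last by apply: prodr_gt0 => i _; exact: aEr1.
rewrite ln_prod// => /le_trans; apply.
rewrite -big_split; apply: ler_sum => i _.
have aErE' : a i + E i * r = q i * (modulus (1 + z i) + w i * r).
  by rewrite aE EE; ring.
rewrite /= aErE' lnM ?posrE//; last by rewrite -(pmulr_rgt0 _ (q0 i)) -aErE'.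
rewrite /log_term -Rez -addrA lerD2l.
exact: (ln_modulus1D_upper delta0 eta0 eta1 delta_le r0 r2 rsmall
  (w0 i) (wd i) (zd i)).
Qed.

Lemma rho_word_estimate n (s : n.-tuple 'I_m.+1) : (1 <= n)%N ->
  0 < rho_word lam Delta eps s /\
  `|ln (rho_word lam Delta eps s) -
    n%:R^-1 * \sum_(k < n) log_term lam Delta eps (tnth s k)| <=
  C_F lam Delta * eps ^+ 2.
Proof.
move=> n1; have n0 : (0 : R) < n%:R by rewrite ltr0n.
have [rho0 rhoE] := ln_spectral_radius_word s.
split; first exact: powR_gt0.
rewrite /rho_word ln_powR -mulrBr normrM ger0_norm ?invr_ge0 ?ler0n//.
rewrite ler_pdivrMl//; move: rhoE; rewrite size_tuple.
by rewrite [X in _ - X]big_tuple.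
Qed.

End Family.

(** * Strong law of large numbers for functions of i.i.d. letters *)

Section StrongLaw.
Context {R : realType}.

(** [expR (- x) >= 1 - x] gives [expR x <= (1 - x)^-1], which falls short of the quadratic by
    [x ^+ 2 * (1 - 2 * x) / (1 - x)]. *)
Lemma expR_le_quadratic (x : R) : `|x| <= 2^-1 -> expR x <= 1 + x + 2 * x ^+ 2.
Proof.
rewrite ler_norml => /andP[xl xu].
have x1 : 0 < 1 - x by lra.
have h : expR x <= (1 - x)^-1.
  by rewrite -[x]opprK expRN lef_pV2 ?posrE ?expR_gt0 ?opprK// expR_ge1Dx.
rewrite (le_trans h)// -subr_ge0.
rewrite (_ : _ - _ = x ^+ 2 * (1 - 2 * x) / (1 - x)); last first.
  by field; rewrite gt_eqF.
have x2 : 0 <= 1 - 2 * x by lra.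
by apply: divr_ge0 (ltW x1); exact: mulr_ge0 (sqr_ge0 x) x2.
Qed.

(* For small theta, E[exp(theta g)] <= 1 + 2 theta^2 M^2 beats exp(theta t). *)
Lemma centered_chernoff (I : finType) (p g : I -> R) (t : R) :
  (forall i, 0 <= p i) -> \sum_i p i = 1 -> \sum_i p i * g i = 0 -> 0 < t ->
  exists2 theta, 0 < theta & \sum_i p i * expR (theta * (g i - t)) < 1.
Proof.
move=> p0 p1 pg0 t0.
pose M := 1 + \sum_i `|g i|.
have M1 : 1 <= M by rewrite lerDl; apply: sumr_ge0.
have M0 : 0 < M by lra.
have gM i : `|g i| <= M.
  by rewrite /M (bigD1 i)//= addrCA lerDl addr_ge0//; apply: sumr_ge0.
(* For [theta = t / den], the first summand ensures [2 * theta * M ^+ 2 < t], the second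
   [theta * M <= 1 / 2]. *)
pose den := 4 * M ^+ 2 + 2 * M * t.
have den0 : 0 < den by rewrite addr_gt0 ?mulr_gt0 ?exprn_gt0.
pose theta := t / den.
have theta0 : 0 < theta by rewrite divr_gt0.
have thetaM : theta * M <= 2^-1.
  rewrite /theta mulrAC ler_pdivrMr// /den.
  have := exprn_gt0 2 M0; lra.
have thetaM2 : 2 * theta * M ^+ 2 < t.
  rewrite /theta mulrA mulrAC ltr_pdivrMr// /den.
  have := exprn_gt0 2 M0; have := mulr_gt0 M0 t0; nra.
exists theta => //.
apply: (@le_lt_trans _ _ (expR (2 * theta ^+ 2 * M ^+ 2 - theta * t))); last first.
  rewrite -[ltRHS]expR0 ltr_expR subr_lt0 (_ : _ * _ = theta * (2 * theta * M ^+ 2)).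
    by rewrite ltr_pM2l.
  by ring.
rewrite expRD -ler_pdivrMr ?expR_gt0// -expRN opprK mulr_suml.
apply: (@le_trans _ _ (1 + 2 * theta ^+ 2 * M ^+ 2)); last exact: expR_ge1Dx.
have -> : 1 + 2 * theta ^+ 2 * M ^+ 2 =
    \sum_i p i * (1 + theta * g i + 2 * theta ^+ 2 * M ^+ 2).
  under eq_bigr do rewrite !mulrDr mulr1 [p _ * (theta * _)]mulrCA.
  by rewrite !big_split/= -mulr_sumr pg0 mulr0 addr0 p1 -mulr_suml p1 mul1r.
apply: ler_sum => i _. rewrite -[leLHS]mulrA -expRD ler_wpM2l//.
rewrite -mulrDr subrK.
have tg : `|theta * g i| <= theta * M by rewrite normrM gtr0_norm// ler_wpM2l// ltW.
rewrite (le_trans (expR_le_quadratic (le_trans tg thetaM)))// lerD2l.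
rewrite -[leRHS]mulrA ler_wpM2l// -exprMn -real_normK ?num_real//.
by rewrite ler_sqr ?nnegrE// mulr_ge0// ltW.
Qed.

(** Distributivity, with words read as functions on positions; it factors the exponential moment of
    an i.i.d. sum into a power. *)
Lemma sum_tuple_prod (I : finType) n (F : I -> R) :
  \sum_(s : n.-tuple I) \prod_(k < n) F (tnth s k) = (\sum_i F i) ^+ n.
Proof.
rewrite -[in RHS](card_ord n) -prodr_const bigA_distr_bigA/=.
rewrite (reindex (fun s : n.-tuple I => [ffun k => tnth s k]))/=; last first.
  exists (fun f : {ffun 'I_n -> I} => [tuple f k | k < n]) => [s _|f _].
    by apply: eq_from_tnth => k; rewrite tnth_mktuple ffunE.
  by apply/ffunP => k; rewrite ffunE tnth_mktuple.
by apply: eq_bigr => s _; apply: eq_bigr => k _; rewrite ffunE.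
Qed.

Context {dT : measure_display} {T : measurableType dT} (P : probability T R).

Lemma measure_bigsetU_le (I : finType) (A : pred I) (F : I -> set T) :
  (forall i, measurable (F i)) ->
  measurable (\big[setU/set0]_(i | A i) F i) /\
  (P (\big[setU/set0]_(i | A i) F i) <= \sum_(i | A i) P (F i))%E.
Proof.
move=> mF; elim/big_rec2: _ => [|i y X _ [mX PX]].
  by split; [exact: measurable0 | rewrite measure0].
split; first exact: measurableU.
by rewrite (le_trans (measureU2 _ _ _))// leeD2l.
Qed.

Lemma geometric_nneseries_lty (q : R) : 0 <= q -> q < 1 ->
  (\sum_(n <oo) (q ^+ n)%:E < +oo)%E.
Proof.
move=> q0 q1.
apply: (@le_lt_trans _ _ ((1 - q)^-1)%:E); last exact: ltry.
apply: lime_le.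
  by apply: is_cvg_nneseries => n _ _; rewrite lee_fin exprn_ge0.
apply: nearW => n; rewrite sumEFin lee_fin -[leRHS]mul1r ler_pdivlMr ?subr_gt0//.
rewrite big_mkord mulrC -opprB mulNr -subrX1 opprB gerBl exprn_ge0//.
Qed.

Context {m : nat} (p : 'I_m.+1 -> R) (omega : nat -> T -> 'I_m.+1).
Hypothesis p0 : forall i, 0 <= p i.
Hypothesis p1 : \sum_i p i = 1.
Hypothesis iid : iid_with_law P p omega.

Lemma prefix_word_preimage n (s : n.-tuple 'I_m.+1) :
  prefix_word omega n @^-1` [set s] =
  \bigcap_(k in [set` iota 0 n]) (omega k @^-1` [set nth ord0 s k]).
Proof.
apply/seteqP; split => w /=.
  move=> <- k /=; rewrite mem_iota/= add0n => kn.
  by have := tnth_nth ord0 (prefix_word omega n w) (Ordinal kn);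
    rewrite tnth_mktuple.
move=> h; apply: eq_from_tnth => k; rewrite tnth_mktuple.
have /= := h k; rewrite mem_iota/= add0n => /(_ (ltn_ord k)) ->.
by rewrite (tnth_nth ord0).
Qed.

Lemma measurable_prefix_word n (s : n.-tuple 'I_m.+1) :
  measurable (prefix_word omega n @^-1` [set s]).
Proof.
have [momega _ _] := iid.
rewrite prefix_word_preimage bigcap_seq.
by apply: bigsetI_measurable => k _; exact: momega.
Qed.

Lemma probability_prefix_word n (s : n.-tuple 'I_m.+1) :
  P (prefix_word omega n @^-1` [set s]) = (\prod_(k < n) p (tnth s k))%:E.
Proof.
have [_ law indep] := iid.
rewrite prefix_word_preimage (indep _ (fun k => [set nth ord0 s k])) ?iota_uniq//.
under eq_bigr do rewrite law.
rewrite prodEFin -[n in iota 0 n]subn0 -/(index_iota 0 n) big_mkord.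
by congr EFin; apply: eq_bigr => k _; rewrite (tnth_nth ord0).
Qed.

(** The bad event [F n] collects the words with sum at least [n * t]. By the Chernoff bound its
    probability is at most [q ^+ n], which is summable. *)
Lemma iid_sum_upper (g : 'I_m.+1 -> R) (t : R) :
  \sum_i p i * g i = 0 -> 0 < t ->
  {ae P, forall w, \forall n \near \oo, \sum_(k < n) g (omega k w) <= n%:R * t}.
Proof.
move=> pg0 t0; have [theta theta0 q1] := centered_chernoff p0 p1 pg0 t0.
set q := \sum_i _ in q1.
have q0 : 0 <= q by apply: sumr_ge0 => i _; rewrite mulr_ge0// expR_ge0.
pose A n (s : n.-tuple 'I_m.+1) := n%:R * t <= \sum_(k < n) g (tnth s k).
pose F n := \big[setU/set0]_(s | A n s) prefix_word omega n @^-1` [set s].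
have mF n : measurable (F n).
  by have [] := measure_bigsetU_le (A n) (@measurable_prefix_word n).
have PF n : (P (F n) <= (q ^+ n)%:E)%E.
  have [_ /le_trans] := measure_bigsetU_le (A n) (@measurable_prefix_word n).
  apply; under eq_bigr do rewrite probability_prefix_word.
  rewrite sumEFin lee_fin -sum_tuple_prod big_mkcond/=; apply: ler_sum => s _.
  rewrite big_split/=; case: ifP => [As|_]; last first.
    by rewrite mulr_ge0// prodr_ge0// => k _; rewrite expR_ge0.
  (* On a bad word the exponential weight is at least 1, so inserting it only increases the sum. *)
  rewrite ler_peMr ?prodr_ge0// -expR_sum -[leLHS]expR0 ler_expR.
  rewrite -mulr_sumr; apply: mulr_ge0 (ltW theta0) _.
  by rewrite sumrB sumr_const card_ord subr_ge0 -mulr_natl.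
have limF : P (lim_sup_set F) = 0%E.
  apply: lim_sup_set_cvg0 => //.
  apply: le_lt_trans (geometric_nneseries_lty q0 q1).
  by apply: lee_nneseries => n _ //; exact: PF.
exists (lim_sup_set F); split => //.
  by apply: bigcapT_measurable => n; apply: bigcup_measurable => k _; exact: mF.
(* If the bound fails to hold eventually, [w] meets [F k] for some [k] beyond every [n]. *)
move=> w /= nw n _; apply: contrapT => wF; apply: nw.
exists n => // k /= nk; rewrite leNgt; apply/negP => /ltW gt; apply: wF.
exists k => //; rewrite /F (bigD1 (prefix_word omega k w))/=; first by left.
by rewrite /A; under eq_bigr do rewrite tnth_mktuple.
Qed.

(** The one-sided bound is applied to both [f - mu] and [mu - f]. *)
Lemma iid_strong_law (f : 'I_m.+1 -> R) :
  {ae P, forall w,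
    n%:R^-1 * (\sum_(k < n) f (omega k w)) @[n --> \oo] --> \sum_i p i * f i}.
Proof.
set mu := \sum_i p i * f i.
have pmu (c : R) : \sum_i p i * (c * (f i - mu)) = 0.
  under eq_bigr do rewrite mulrCA mulrBr.
  by rewrite -mulr_sumr sumrB -mulr_suml p1 mul1r subrr mulr0.
(* Countably many tolerances [1 / (j + 1)] suffice, so the exceptional null sets can be united. *)
suff : {ae P, forall w, forall j : nat, \forall n \near \oo,
    `|mu - n%:R^-1 * (\sum_(k < n) f (omega k w))| <= j.+1%:R^-1}.
  apply: filterS => w h; apply/cvgrPdist_le => e e0.
  apply: filterS (h (Num.bound e^-1)) => n /le_trans; apply.
  rewrite invf_ple ?posrE//; apply: (@le_trans _ _ (Num.bound e^-1)%:R).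
    by rewrite ltW// archi_boundP// invr_ge0 ltW.
  by rewrite ler_nat.
apply/ae_foralln => j.
have j0 : (0 : R) < j.+1%:R^-1 by rewrite invr_gt0.
have up := iid_sum_upper (pmu 1) j0; have low := iid_sum_upper (pmu (-1)) j0.
apply: filterS2 up low => w up low; near=> n.
have n0 : (0 : R) < n%:R by rewrite ltr0n; near: n; exact: nbhs_infty_gt.
have sumE (c : R) : \sum_(k < n) c * (f (omega k w) - mu) =
    n%:R * (c * (n%:R^-1 * (\sum_(k < n) f (omega k w)) - mu)).
  rewrite -mulr_sumr sumrB sumr_const card_ord [RHS]mulrCA.
  rewrite [in RHS]mulrBr mulVKf ?gt_eqF//.
  by rewrite mulr_natl.
have h1 : \sum_(k < n) 1 * (f (omega k w) - mu) <= n%:R * j.+1%:R^-1.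
  by near: n; exact: up.
have h2 : \sum_(k < n) -1 * (f (omega k w) - mu) <= n%:R * j.+1%:R^-1.
  by near: n; exact: low.
move: h1 h2; rewrite !sumE !ler_pM2l// mul1r mulN1r => h1 h2.
by rewrite distrC ler_norml h1 andbT lerNl.
Unshelve. all: by end_near. Qed.

End StrongLaw.

(** * Eventual bounds pass to upper and lower limits *)

Section LimitSuperior.
Context {R : realType}.
Local Open Scope ereal_scope.
Implicit Types (u : (\bar R)^nat) (l : \bar R).

(** The upper limit is an infimum of suprema over eventual index sets, and the set where [u n <= l]
    is one of them. *)
Lemma limn_esup_le_near u l : (\forall n \near \oo, u n <= l) -> limn_esup u <= l.
Proof.
move=> ul; apply: (@le_trans _ _ (ereal_sup [set u x | x in [set n | u n <= l]])).
  by apply: ereal_inf_lbound; exists [set n | u n <= l].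
by apply: ge_ereal_sup => _ [n /= nl <-].
Qed.

Lemma limn_einf_ge_near u l : (\forall n \near \oo, l <= u n) -> l <= limn_einf u.
Proof.
move=> lu; rewrite leeNr; apply: limn_esup_le_near.
by apply: filterS lu => n; rewrite leeN2.
Qed.

End LimitSuperior.

(** * From logarithmic bounds to bounds on the limits themselves *)

Section ExpLimits.
Context {R : realType}.
Implicit Types (rho : R^nat) (c : R).

(** An additive slack [e] above [expR c] is the logarithmic slack [ln (1 + e / expR c)]. *)
Lemma limn_esup_expR_le rho c :
  (forall e : R, 0 < e -> \forall n \near \oo, 0 < rho n /\ ln (rho n) <= c + e) ->
  (limn_esup (fun n => (rho n)%:E) <= (expR c)%:E)%E.
Proof.
move=> h; apply/lee_addgt0Pr => e e0; rewrite -EFinD.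
have c0 := expR_gt0 c.
have r1 : 1 < 1 + e / expR c by rewrite ltrDl divr_gt0.
apply: limn_esup_le_near.
apply: filterS (h _ (ln_gt0 r1)) => n [rho0 hn]; rewrite lee_fin.
rewrite -(lnK (x := rho n)) ?posrE//.
rewrite (le_trans (y := expR (c + ln (1 + e / expR c))))//.
  by rewrite ler_expR.
rewrite expRD lnK ?posrE ?(lt_trans ltr01)// mulrDr mulr1 mulrCA divff ?mulr1//.
by rewrite gt_eqF.
Qed.

(** The logarithmic slack [e / expR c] costs at most [e], by [expR (- u) >= 1 - u]. *)
Lemma limn_einf_expR_ge rho c :
  (forall e : R, 0 < e -> \forall n \near \oo, 0 < rho n /\ c - e <= ln (rho n)) ->
  ((expR c)%:E <= limn_einf (fun n => (rho n)%:E))%E.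
Proof.
move=> h; apply/lee_addgt0Pr => e e0.
have c0 := expR_gt0 c.
rewrite -leeBlDr// -EFinB; apply: limn_einf_ge_near.
apply: filterS (h _ (divr_gt0 e0 c0)) => n [rho0 hn]; rewrite lee_fin.
rewrite -(lnK (x := rho n)) ?posrE//.
rewrite (le_trans (y := expR (c - e / expR c)))// ?ler_expR// expRD.
rewrite -[leLHS](_ : expR c * (1 - e / expR c) = _).
  by rewrite ler_pM2l// expR_ge1Dx.
by rewrite mulrBr mulr1 mulrCA divff ?mulr1// gt_eqF.
Qed.

End ExpLimits.

Theorem theorem9 (R : realType) :
  exists eps0 : R -> R -> R -> R,
  forall (d m : nat) (lam : 'I_m.+1 -> 'rV[R[i]]_d.+2)
    (Delta : 'I_m.+1 -> 'M[R[i]]_d.+2) (p : 'I_m.+1 -> R),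
  (forall i, simple_nonzero_eigenvalues (diag_mx (lam i))) ->
  (forall i (r : 'I_d.+2), r != 0 ->
     modulus (lam i 0 r) < modulus (lam i 0 0)) ->
  (forall i, frobenius (Delta i) = 1) ->
  (forall i, 0 <= p i) -> \sum_(i < m.+1) p i = 1 ->
  let e0 := eps0 (ratio_eta lam) (lambda_min lam) (Delta_max Delta) in
  [/\ ratio_eta lam < 1,
      0 < e0,
      forall eps : R, `|eps| <= e0 ->
      forall (n : nat) (s : n.-tuple 'I_m.+1), (1 <= n)%N ->
        0 < rho_word lam Delta eps s /\
        exists Rn : R,
          ln (rho_word lam Delta eps s) =
            n%:R^-1 * (\sum_(k < n) log_term lam Delta eps (tnth s k)) + Rn
          /\ `|Rn| <= C_F lam Delta * eps ^+ 2
    & forall eps : R, `|eps| <= e0 ->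
      forall (dT : measure_display) (T : measurableType dT)
        (P : probability T R) (omega : nat -> T -> 'I_m.+1),
      iid_with_law P p omega ->
      {ae P, forall w,
        (limn_esup (fun n =>
           `|ln (rho_word lam Delta eps (prefix_word omega n w))
             - mu_tilde lam Delta p eps|%:E)
         <= (C_F lam Delta * eps ^+ 2)%:E)%E}
      /\
      {ae P, forall w,
        let rho n := (rho_word lam Delta eps (prefix_word omega n w))%:E in
        [/\ ((expR (- (C_F lam Delta * eps ^+ 2))
              * rho_tilde lam Delta p eps)%:E <= limn_einf rho)%E,
            (limn_einf rho <= limn_esup rho)%E
          & (limn_esup rho
             <= (expR (C_F lam Delta * eps ^+ 2)
                 * rho_tilde lam Delta p eps)%:E)%E]}].
Proof.
(* Since [Delta_max = 1], this threshold says exactly that [|eps| / lambda_min <= (1 - eta) / 5]. *)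
exists (fun eta l D => l * (1 - eta) / (5 * D)).
move=> d m lam Delta p _ lam_dom Delta1 p0 p1 e0.
have lmin0 := lambda_min_gt0 lam_dom; have eta1 := ratio_eta_lt1 lam_dom.
split=> //.
- by rewrite /e0 divr_gt0 ?mulr_gt0 ?subr_gt0// (Delta_max_eq1 Delta1).
- move=> eps epsle n s n1.
  have [rho0 rhoE] := rho_word_estimate lam_dom Delta1 epsle s n1.
  split=> //.
  exists (ln (rho_word lam Delta eps s) -
    n%:R^-1 * (\sum_(k < n) log_term lam Delta eps (tnth s k))); split=> //.
  by rewrite addrC subrK.
move=> eps epsle dT T P omega iid.
set C := C_F lam Delta * eps ^+ 2; set mu := mu_tilde lam Delta p eps.
(* Both almost sure claims are read off on this one event; the strong law is applied to [log_term],
   whose mean is [mu]. *)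
have lnE : {ae P, forall w, forall e : R, 0 < e -> \forall n \near \oo,
    0 < rho_word lam Delta eps (prefix_word omega n w) /\
    `|ln (rho_word lam Delta eps (prefix_word omega n w)) - mu| <= C + e}.
  apply: filterS (iid_strong_law p0 p1 iid (log_term lam Delta eps)) => w.
  move=> /cvgrPdist_le cvg e egt0; near=> n.
  have n1 : (1 <= n)%N by near: n; exact: nbhs_infty_ge.
  have [rho0 rhoE] :=
    rho_word_estimate lam_dom Delta1 epsle (prefix_word omega n w) n1.
  split=> //; rewrite (le_trans (ler_distD _ _ _) (lerD rhoE _))//.
  under eq_bigr do rewrite tnth_mktuple.
  by rewrite distrC; near: n; exact: cvg.
split.
  apply: filterS lnE => w h; apply/lee_addgt0Pr => e egt0.
  apply: limn_esup_le_near; rewrite -EFinD.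
  by apply: filterS (h _ egt0) => n [_ hn]; rewrite lee_fin.
apply: filterS lnE => w h; split.
- rewrite /rho_tilde -expRD; apply: limn_einf_expR_ge => e egt0.
  apply: filterS (h _ egt0) => n [rho0]; rewrite ler_distl => /andP[hn _].
  by split=> //; rewrite (le_trans _ hn)//; rewrite -/mu; lra.
- exact: limn_einf_sup.
- rewrite /rho_tilde -expRD; apply: limn_esup_expR_le => e egt0.
  apply: filterS (h _ egt0) => n [rho0]; rewrite ler_distl => /andP[_ hn].
  by split=> //; rewrite (le_trans hn)//; rewrite -/mu; lra.
Unshelve. all: by end_near. Qed.
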